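(* Let $R$ be a ring. Then the following two statements are equivalent: (1) $R$ is a strongly $J$-clean ring. (2) $R$ is a strongly $J^{\#}$-clean ring.
   Context: All rings are associative with identity, not necessarily commutative. $J(R)$ denotes the Jacobson radical of $R$ and $J^{\#}(R)=\{z\in R : z^n\in J(R)\text{ for some } n\ge 1\}$. A ring $R$ is strongly $J$-clean (respectively strongly $J^{\#}$-clean) if every $a\in R$ can be written $a=e+j$ with $e^2=e\in R$, $ej=je$ and $j\in J(R)$ (respectively $j\in J^{\#}(R)$). *)

(* Defs.v *)
From mathcomp Require Import all_boot all_algebra.
From mathcomp Require Import classical_sets.

Set Implicit Arguments.
Unset Strict Implicit.
Unset Printing Implicit Defensive.

Import GRing.Theory.
Local Open Scope classical_set_scope.
Local Open Scope ring_scope.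

(* [idealr_closed] of ring_quotient is not used: it is restricted to nontrivial
   rings and to boolean predicates, whereas ideals here are arbitrary subsets
   of a possibly trivial ring. *)
Definition left_ideal (R : pzRingType) (I : set R) : Prop :=
  [/\ I 0,
      forall x y, I x -> I y -> I (x - y) &
      forall a x, I x -> I (a * x)].

Definition maximal_left_ideal (R : pzRingType) (M : set R) : Prop :=
  [/\ left_ideal M,
      M <> setT &
      forall I : set R, left_ideal I -> M `<=` I -> I = M \/ I = setT].

(* If R is trivial there is no maximal left ideal, and the intersection is R. *)
Definition Jacobson (R : pzRingType) : set R :=
  \bigcap_(M in @maximal_left_ideal R) M.

Definition Jsharp (R : pzRingType) : set R :=
  [set z | exists n : nat, (1 <= n)%N /\ Jacobson (z ^+ n)].

Definition strongly_J_clean (R : pzRingType) : Prop :=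
  forall a : R, exists e j : R,
    [/\ a = e + j, e ^+ 2 = e, e * j = j * e & Jacobson j].

Definition strongly_Jsharp_clean (R : pzRingType) : Prop :=
  forall a : R, exists e j : R,
    [/\ a = e + j, e ^+ 2 = e, e * j = j * e & Jsharp j].

(* Main.v *)
Require Import Defs.
From HB Require Import structures.
From mathcomp Require Import all_boot all_algebra.
From mathcomp Require Import boolp classical_sets.

(** Since [J] is contained in [J#], only the implication from strongly
    [J#]-clean to strongly [J]-clean needs an argument, and there it suffices
    that [J#] is contained in [J].  The quotient [S] by [J] is strongly nil
    clean: every element is the sum of an idempotent and a commuting nilpotent.
    Halving a power-of-two exponent repeatedly, it is enough to treat [x] with
    [x ^ 2] in [J], and [x] lies in [J] as soon as all the multiples [s x] are
    nilpotent modulo [J].  So everything reduces to one fact about a strongly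
    nil clean ring [S]: if [x ^ 2 = 0] then [x y] is nilpotent for every [y].

    The units of [S] are unipotent ([unit_unipotent]).  If [x] and [z] both have
    square zero, then [(1 + x) (1 + z)] is a unit, and its being unipotent
    forces [x z] to be nilpotent ([nilpotent_mul_square_zero]).  The typical
    case excluded is that of the matrix units [x = e12] and [z = e21], for which
    [(1 + x) (1 + z) - 1] is the invertible matrix with rows [(1, 1)], [(1, 0)].

    For an arbitrary [y], split [x y = f + w].  The idempotent [f] lies in the
    right ideal [x S], say [f = x r], and [x] kills [f]; replacing [r] by
    [z = (1 - f) r] keeps [x z = f] and makes [z] of square zero.  Then [f] is
    both idempotent and nilpotent, so [f = 0] and [x y = w]
    ([nilpotent_mul_of_square_zero]). *)

Set Implicit Arguments.
Unset Strict Implicit.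
Unset Printing Implicit Defensive.

Import GRing.Theory.
Local Open Scope classical_set_scope.
Local Open Scope ring_scope.

(** * The Jacobson radical *)

Lemma left_idealD (R : pzRingType) (I : set R) x y :
  left_ideal I -> I x -> I y -> I (x + y).
Proof.
move=> [I0 IB _] Ix Iy; rewrite -[y]opprK; apply: (IB) => //.
by rewrite -sub0r; exact: IB.
Qed.

(** The left ideal generated by [M] and [x] is everything once [x] lies outside
    the maximal left ideal [M]. *)
Lemma maximal_left_ideal_comaximal (R : pzRingType) (M : set R) x :
  maximal_left_ideal M -> ~ M x -> exists s, M (1 - s * x).
Proof.
move=> [[M0 MB MM] _ Mmax] Mx.
pose I : set R := [set y | exists s, M (y - s * x)].
have LI : left_ideal I.
  split; first by exists 0; rewrite mul0r subr0.
    move=> y z [s Ms] [t Mt]; exists (s - t).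
    by rewrite mulrBl opprD addrACA -opprD; exact: MB.
  by move=> a y [s Ms]; exists (a * s); rewrite -mulrA -mulrBr; exact: MM.
have sMI : M `<=` I by move=> y My; exists 0; rewrite mul0r subr0.
case: (Mmax I LI sMI) => IE.
  by case: Mx; rewrite -IE; exists 1; rewrite mul1r subrr.
by have : I 1 by rewrite IE.
Qed.

Lemma maximal_left_ideal1 (R : pzRingType) (M : set R) :
  maximal_left_ideal M -> ~ M 1.
Proof.
move=> [[_ _ MM] MT _] M1; apply: MT; apply/seteqP; split=> // a _.
by rewrite -[a]mulr1; exact: MM.
Qed.

Lemma Jacobson_left_ideal (R : pzRingType) : left_ideal (@Jacobson R).
Proof.
split=> [M [[]] //|x y Jx Jy M MM|a x Jx M MM].
  by case: (MM) => [[_ MB _] _ _]; apply: MB; [exact: Jx|exact: Jy].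
by case: (MM) => [[_ _ MX] _ _]; apply: MX; exact: Jx.
Qed.

(** For [b] outside a maximal left ideal [M], the quotient [(M : b)] is again
    a maximal left ideal, so it contains the radical. *)
Lemma Jacobson_mulr (R : pzRingType) (x b : R) :
  Jacobson x -> Jacobson (x * b).
Proof.
move=> Jx M MM; have [[M0 MB MX] _ _] := MM.
have [Mb|Mb] := pselect (M b); first exact: MX.
apply: (Jx [set a | M (a * b)]); split; first split.
- by rewrite /= mul0r.
- by move=> y z /= My Mz; rewrite mulrBl; exact: MB.
- by move=> a y /= My; rewrite -mulrA; exact: MX.
- move=> E; have : [set a | M (a * b)] 1 by rewrite E.
  by rewrite /= mul1r.
move=> I [I0 IB IX] sub.
have [sI|nsI] := pselect (I `<=` [set a | M (a * b)]).
  by left; apply/seteqP.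
right; have [y Iy My] : exists2 y, I y & ~ M (y * b).
  apply: contra_notP nsI => h y Iy /=.
  by apply: contrapT => My; apply: h; exists y.
have [s Ms] := maximal_left_ideal_comaximal MM My.
have I1 : I 1.
  rewrite -[1](subrK (b * s * y)); apply: left_idealD; first by [].
    apply: sub => /=; rewrite mulrBl mul1r -!mulrA -[X in X - _]mulr1 -mulrBr.
    exact: MX.
  exact: IX.
by apply/seteqP; split=> // a _; rewrite -[a]mulr1; exact: IX.
Qed.

(** If [x] is outside the maximal left ideal [M], then [s * x] is congruent to
    [1] modulo [M] for some [s], and so are its powers, because [1 - s * x] is a
    right factor of [1 - (s * x) ^+ n]; no such power can be in [M]. *)
Lemma Jacobson_of_nil_multiples (R : pzRingType) (x : R) :
  (forall s, exists n, Jacobson ((s * x) ^+ n)) -> Jacobson x.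
Proof.
move=> nilx M MM; apply: contrapT => Mx.
have [s Ms] := maximal_left_ideal_comaximal MM Mx.
have [n Jn] := nilx s.
have [LM _ _] := MM; have [_ _ MX] := LM.
apply: (maximal_left_ideal1 MM).
rewrite -[1](subrK ((s * x) ^+ n)); apply: left_idealD => //; last exact: Jn.
have -> : 1 - (s * x) ^+ n = (\sum_(i < n) (s * x) ^+ i) * (1 - s * x).
  have /esym c : GRing.comm (1 - s * x) (\sum_(i < n) (s * x) ^+ i).
    apply: commr_sum => i _; apply: commrX; apply/commr_sym.
    by apply: commrB; [exact: commr1|].
  by rewrite c -[LHS]opprB subrX1 -[LHS]mulNr opprB.
exact: MX.
Qed.

(** * Quotient by a two-sided ideal *)

(** The ring is built on the quotient of the additive group, with [a * b]
    computed on representatives; two-sidedness makes this well defined. *)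
Lemma quotient_ring (R : pzRingType) (I : set R) :
  left_ideal I -> (forall x b, I x -> I (x * b)) ->
  exists (S : pzRingType) (pi : {rmorphism R -> S}),
    (forall s, exists a, pi a = s) /\ (forall x, pi x = 0 <-> I x).
Proof.
move=> [I0 IB IMl] IMr.
pose P : {pred R} := fun x => `[< I x >].
have PP : zmod_closed P.
  split; first exact/asboolP.
  by move=> x y /asboolP Ix /asboolP Iy; apply/asboolP; exact: IB.
pose K : zmodClosed R := HB.pack P (GRing.isZmodClosed.Build R P PP).
pose Q := Quotient.quot K.
pose p : R -> Q := \pi_Q%qT.
have pE x y : p x = p y <-> I (x - y).
  split=> [/eqP|h]; first by rewrite -Quotient.idealrBE => /asboolP.
  by apply/eqP; rewrite -Quotient.idealrBE; apply/asboolP.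
have rK (q : Q) : p (repr q) = q := reprK q.
have pB : zmod_morphism p by move=> x y; rewrite /p raddfB.
have pD x y : p (x + y) = p x + p y by rewrite /p raddfD.
pose mul (x y : Q) : Q := p (repr x * repr y).
have pM x y : p (x * y) = mul (p x) (p y).
  apply/pE; rewrite -[x * y](subrK (x * repr (p y))) -addrA -mulrBr -mulrBl.
  apply: left_idealD => //; last by apply/IMr/pE; rewrite rK.
  by apply/IMl/pE; rewrite rK.
have mulA : associative mul.
  by move=> x y z; rewrite -[x]rK -[y]rK -[z]rK -!pM mulrA.
have mul1 : left_id (p 1) mul by move=> x; rewrite -[x]rK -pM mul1r.
have mulr1 : right_id (p 1) mul by move=> x; rewrite -[x]rK -pM mulr1.
have mulDl : left_distributive mul +%R.
  by move=> x y z; rewrite -[x]rK -[y]rK -[z]rK -pD -!pM -pD mulrDl.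
have mulDr : right_distributive mul +%R.
  by move=> x y z; rewrite -[x]rK -[y]rK -[z]rK -pD -!pM -pD mulrDr.
pose S : pzRingType := HB.pack Q
  (GRing.Zmodule_isPzRing.Build Q mulA mul1 mulr1 mulDl mulDr).
pose pi : {rmorphism R -> S} := HB.pack (p : R -> S)
  (GRing.isZmodMorphism.Build R S p pB)
  (GRing.isMonoidMorphism.Build R S p (conj erefl pM)).
exists S, pi; split=> [s|x]; first by exists (repr s); exact: rK.
by rewrite -[x in I x]subr0 -pE -[0 in RHS](rmorph0 pi).
Qed.

(** * Nilpotent elements and strongly nil clean rings *)

Definition nilpotent (R : pzRingType) (x : R) : Prop := exists n, x ^+ n = 0.

Definition strongly_nil_clean (R : pzRingType) : Prop :=
  forall a : R, exists e w : R,
    [/\ a = e + w, e ^+ 2 = e, e * w = w * e & nilpotent w].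

Lemma nilpotentMr (R : pzRingType) (x y : R) :
  GRing.comm x y -> nilpotent x -> nilpotent (x * y).
Proof. by move=> c [n xn]; exists n; rewrite exprMn_comm // xn mul0r. Qed.

Lemma comm_inverse (R : pzRingType) (x u v : R) :
  u * v = 1 -> v * u = 1 -> GRing.comm x u -> GRing.comm x v.
Proof.
move=> uv vu c.
by rewrite /GRing.comm -[x * v]mul1r -vu -mulrA [u * _]mulrA -c -mulrA uv mulr1.
Qed.

Lemma unipotent_inverse (R : pzRingType) (w : R) :
  nilpotent w -> exists v, (1 + w) * v = 1 /\ v * (1 + w) = 1.
Proof.
move=> [n wn]; exists (\sum_(i < n) (- w) ^+ i).
have E : (1 + w) * (\sum_(i < n) (- w) ^+ i) = 1.
  have := subrX1 (- w) n.
  rewrite exprNn wn mulr0 sub0r -opprD [w + 1]addrC mulNr.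
  by move/oppr_inj.
split=> //; rewrite -[RHS]E; apply/esym/commr_sum => i _; apply: commrX.
by apply/commrN/commr_sym/commrD; [exact: commr1|].
Qed.

(** Splitting a unit [u] as [e + w], the idempotent [1 - e] is killed by a
    power of [u], since [u] and [w] agree on it; hence [e = 1]. *)
Lemma unit_unipotent (R : pzRingType) (u v : R) :
  strongly_nil_clean R -> u * v = 1 -> v * u = 1 -> nilpotent (u - 1).
Proof.
move=> snc uv vu; have [e [w [uE e2 ew [k wk]]]] := snc u.
have uf : u * (1 - e) = w * (1 - e).
  by rewrite uE mulrDl [e * _]mulrBr mulr1 -expr2 e2 subrr add0r.
have fw : GRing.comm w (1 - e).
  by apply: commrB; [exact: commr1|exact/esym].
have ufk n : u ^+ n * (1 - e) = w ^+ n * (1 - e).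
  elim: n => [//|n IH]; rewrite exprSr -mulrA uf fw mulrA IH.
  by rewrite -mulrA -fw mulrA -exprSr.
have vuk : v ^+ k * u ^+ k = 1.
  by rewrite -exprMn_comm ?vu ?expr1n // /GRing.comm uv.
have f0 : 1 - e = 0.
  have := congr1 ( *%R (v ^+ k)) (ufk k).
  by rewrite mulrA vuk wk mul1r mul0r mulr0.
by exists k; rewrite uE -(subr0_eq f0) addrC addKr.
Qed.

(** The product of the unipotent units [1 + x] and [1 + z] is unipotent, so
    [n := x + z + x * z] is nilpotent.  On the ring generated by [x] and [z],
    modelled on the [2 x 2] matrices with rows [(0, t)], [(0, 0)] and [(0, 0)],
    [(1, 0)], the element [t := x * z + z * x] is central and [n] has trace [t]
    and determinant [- t].  Cayley-Hamilton reads [n ^+ 2 = t * (1 + n)], where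
    [1 + n] is a unit, so [t] is nilpotent; finally
    [(x * z) ^+ m * x = x * t ^+ m]. *)
Lemma nilpotent_mul_square_zero (R : pzRingType) (x z : R) :
  strongly_nil_clean R -> x * x = 0 -> z * z = 0 -> nilpotent (x * z).
Proof.
move=> snc xx zz.
have xxA y : x * (x * y) = 0 by rewrite mulrA xx mul0r.
have zzA y : z * (z * y) = 0 by rewrite mulrA zz mul0r.
have inv (y : R) : y * y = 0 -> (1 + y) * (1 - y) = 1 /\ (1 - y) * (1 + y) = 1.
  move=> yy; rewrite !mulrDl !mulrDr !mulr1 !mul1r mulrN mulNr yy oppr0.
  by rewrite !addr0 addrK subrK.
have [x1 x2] := inv _ xx; have [z1 z2] := inv _ zz.
set u := (1 + x) * (1 + z); set v := (1 - z) * (1 - x).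
have uv : u * v = 1 by rewrite /u /v mulrA -[X in X * _]mulrA z1 mulr1.
have vu : v * u = 1 by rewrite /u /v mulrA -[X in X * _]mulrA x2 mulr1.
have := unit_unipotent snc uv vu; set n := u - 1 => nil_n.
have nE : n = x + z + x * z.
  rewrite /n /u mulrDl !mulrDr !mulr1 !mul1r -[1 + z + _]addrA.
  by rewrite addrAC subrr add0r addrCA addrA.
have uE : u = 1 + n by rewrite /n addrC subrK.
pose t := x * z + z * x.
have n2 : n * n = t * u.
  rewrite uE nE /t !(mulrDr, mulrDl, mulr1, mul1r, =^~ mulrA).
  rewrite !(xx, zz, xxA, zzA, addr0, add0r, mulr0).
  by rewrite [z * x + _ + _]addrAC [z * x + x * z]addrC -!addrA.
have tE : t = n * n * v by rewrite n2 -mulrA uv mulr1.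
have [k tk] : nilpotent t.
  rewrite tE; have cnu : GRing.comm n u.
    by rewrite uE; apply: commrD; [exact: commr1|].
  have cnv := comm_inverse uv vu cnu.
  rewrite -mulrA; apply: nilpotentMr => //.
  by apply: commrM.
exists k.+1; have xt m : x * t ^+ m = (x * z) ^+ m * x.
  elim: m => [|m IH]; first by rewrite !expr0 mulr1 mul1r.
  rewrite exprSr mulrA IH exprSr -!mulrA /t mulrDr xxA add0r //.
by rewrite exprSr mulrA -xt tk mulr0 mul0r.
Qed.

(** An idempotent [f] of [x * R] is killed by [x], so when [f = x * r] the
    factor [r] can be corrected to [z = (1 - f) * r], of square zero, without
    changing the product. *)
Lemma nilpotent_mul_of_square_zero (R : pzRingType) (x y : R) :
  strongly_nil_clean R -> x * x = 0 -> nilpotent (x * y).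
Proof.
move=> snc xx; have [f [w [aE f2 fw nil_w]]] := snc (x * y).
have [v [wv vw]] := unipotent_inverse nil_w.
(* [x * y * f = (1 + w) * f], so multiplying by the inverse [v] of [1 + w],
   which commutes with [f], exhibits [f] as a right multiple of [x]. *)
have ff : f * f = f by rewrite -expr2.
have cfv : GRing.comm f v.
  by apply: (comm_inverse wv vw); apply: commrD; [exact: commr1|].
pose r := y * v * f.
have rf : r * f = r by rewrite /r -mulrA ff.
have fE : x * r = f.
  have -> : x * r = (f + w) * v * f by rewrite -aE /r !mulrA.
  have fa : (f + w) * f = (1 + w) * f by rewrite !mulrDl ff mul1r.
  by rewrite -mulrA -cfv mulrA fa -mulrA cfv mulrA wv mul1r.
have xf : x * f = 0 by rewrite -fE mulrA xx mul0r.
pose z := (1 - f) * r.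
have zz : z * z = 0.
  have rf0 : r * (1 - f) = 0 by rewrite mulrBr mulr1 rf subrr.
  by rewrite /z -mulrA [r * _]mulrA rf0 mul0r mulr0.
have xz : x * z = f by rewrite /z mulrA mulrBr mulr1 xf subr0.
have [k fk] := nilpotent_mul_square_zero snc xx zz.
have f0 : f = 0.
  rewrite xz in fk.
  case: k fk => [|k]; first by rewrite expr0 => h; rewrite -[f]mulr1 h mulr0.
  have fX m : f ^+ m.+1 = f by elim: m => // m IH; rewrite exprSr IH ff.
  by rewrite fX.
by rewrite aE f0 add0r.
Qed.

(** * Strongly J#-clean rings *)

Lemma Jacobson_of_square (R : pzRingType) (x : R) :
  strongly_Jsharp_clean R -> Jacobson (x ^+ 2) -> Jacobson x.
Proof.
move=> sJ Jx2.
have [S [pi [surj ker]]] :=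
  quotient_ring (@Jacobson_left_ideal R) (@Jacobson_mulr R).
have snc : strongly_nil_clean S.
  move=> s; have [a <-] := surj s; have [e [j [-> e2 ej [n [_ Jn]]]]] := sJ a.
  exists (pi e), (pi j); split; rewrite -?rmorphXn -?rmorphM ?raddfD ?e2 ?ej //.
  by exists n; rewrite -rmorphXn; apply/ker.
have xx : pi x * pi x = 0 by rewrite -rmorphM -expr2; apply/ker.
apply: Jacobson_of_nil_multiples => s.
have [n] := nilpotent_mul_of_square_zero (pi s) snc xx.
rewrite -rmorphM -rmorphXn => /ker Jn; exists n.+1.
(* [x * s] is nilpotent modulo the radical; [s * x] then is one step later. *)
have -> : (s * x) ^+ n.+1 = s * ((x * s) ^+ n * x).
  elim: n {Jn} => [|n IH]; first by rewrite expr1 expr0 mul1r.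
  by rewrite exprS IH [in RHS]exprS !mulrA.
by case: (@Jacobson_left_ideal R) => _ _; apply; exact: Jacobson_mulr.
Qed.

Lemma Jsharp_sub_Jacobson (R : pzRingType) :
  strongly_Jsharp_clean R -> @Jsharp R `<=` @Jacobson R.
Proof.
move=> sJ z [n [_ Jn]].
have : Jacobson (z ^+ (2 ^ n)).
  rewrite -(subnK (ltnW (ltn_expl n (isT : 1 < 2)%N))) exprD.
  by case: (@Jacobson_left_ideal R) => _ _; apply.
elim: n {Jn} => [|n IH]; first by rewrite expr1.
by rewrite expnS mulnC exprM => /(Jacobson_of_square sJ).
Qed.

Theorem theorem5p6 (R : pzRingType) :
  strongly_J_clean R <-> strongly_Jsharp_clean R.
Proof.
split=> clean a; have [e [j [aE e2 ej Jj]]] := clean a; exists e, j; split=> //.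
  by exists 1; rewrite expr1.
exact: Jsharp_sub_Jacobson clean _ Jj.
Qed.
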